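(* Let $R$ be a ring which contains $\mathbb{Q}$ as a subring. Then $R$ has infinitely many maximal subrings up to isomorphism.
   Context: All rings are commutative with $1\neq 0$; subrings and homomorphisms are unital. A proper subring $S$ of $R$ is a maximal subring of $R$ if it is maximal with respect to inclusion among the proper subrings of $R$. ''Up to isomorphism'' means that subrings are counted up to ring isomorphism. *)

(* Defs.v *)
From HB Require Import structures.
From mathcomp Require Import all_boot all_order all_algebra.
From mathcomp Require Import boolp classical_sets cardinality.

Set Implicit Arguments.
Unset Strict Implicit.
Unset Printing Implicit Defensive.

Import GRing.Theory.
Local Open Scope ring_scope.
Local Open Scope classical_set_scope.

(* Subrings are boolean predicates; classically (via [asbool]) this covers
   every subset closed under the ring operations. *)
Definition subring_sort (R : comNzRingType) (S : subringClosed R) : Type :=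
  {x : R | x \in S}.

HB.instance Definition _ (R : comNzRingType) (S : subringClosed R) :=
  SubChoice.copy (subring_sort S) {x : R | x \in S}.
HB.instance Definition _ (R : comNzRingType) (S : subringClosed R) :=
  [SubChoice_isSubComNzRing of subring_sort S by <:].

Definition ring_isomorphic (A B : nzRingType) : Prop :=
  exists f : {rmorphism A -> B}, bijective f.

Definition proper_subring (R : comNzRingType) (S : subringClosed R) : Prop :=
  exists x : R, x \notin S.

Definition maximal_subring (R : comNzRingType) (S : subringClosed R) : Prop :=
  proper_subring S /\
  forall T : subringClosed R,
    proper_subring T -> {subset S <= T} -> S =i T.

Definition maximal_subring_class (R : comNzRingType) (S : subringClosed R) :
    set (subringClosed R) :=
  [set T | maximal_subring T /\
           ring_isomorphic (subring_sort S) (subring_sort T)].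

Definition maximal_subring_classes (R : comNzRingType) :
    set (set (subringClosed R)) :=
  [set maximal_subring_class S | S in [set S | maximal_subring S]].
Arguments maximal_subring_classes R : clear implicits.

(* Main.v *)
(* For each prime p we build a maximal subring S_p of R in which p is not
   invertible but every other prime is; the S_p are then pairwise
   non-isomorphic.

   Let f : R -> K be a homomorphism to a field. By Zorn's lemma there is a
   maximal D among the discrete valuation subrings of K with uniformizer p that
   contain the localization of Z at p. If y were transcendental over D, the
   quotients f(y)/g(y) with g primitive would form a larger one (the Gauss
   extension), so K is algebraic over D, hence every element of K has a multiple
   by a power of p in the integral closure A of D, while 1/p is not in A.
   The preimage B of A in R satisfies B[1/p] = R, so a subring of R containing B
   and maximal for not containing 1/p is a maximal subring of R. *)
From HB Require Import structures.
Require Import Defs.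
From mathcomp Require Import all_boot all_order all_algebra.
From mathcomp Require Import boolp classical_sets cardinality.

Set Implicit Arguments.
Unset Strict Implicit.
Unset Printing Implicit Defensive.

Import GRing.Theory.
Local Open Scope ring_scope.
Local Open Scope classical_set_scope.
Local Open Scope quotient_scope.

(** * Zorn's lemma for subrings and ideals *)

(** Zorn's lemma is applied to the sets [X] with [P (A]|[X)], which forces the maximal set to lie
    above [A]; the empty chain is covered by [P A]. *)
Lemma Zorn_above (T : Type) (P : set (set T)) (A : set T) : P A ->
    (forall F : set (set T), F !=set0 -> F `<=` P -> total_on F subset ->
      P (\bigcup_(X in F) X)) ->
  exists B, [/\ P B, A `<=` B & forall C, P C -> B `<=` C -> C `<=` B].
Proof.
move=> PA Pchain.
have [F FP Ftot|X [PX Xmax]] := @Zorn_bigcup T (fun X => P (A `|` X)).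
  have [->|/set0P[X0 FX0]] := eqVneq F set0; first by rewrite bigcup_set0 setU0.
  have -> : A `|` \bigcup_(X in F) X = \bigcup_(Y in [set A `|` X | X in F]) Y.
    apply/seteqP; split=> [x [Ax|[X FX Xx]]|x [_ [X FX <-] [Ax|Xx]]].
    - by exists (A `|` X0); [exists X0|left].
    - by exists (A `|` X); [exists X|right].
    - by left.
    - by right; exists X.
  apply: Pchain; first by exists (A `|` X0); exists X0.
    by move=> _ [X FX <-]; apply: FP.
  move=> _ _ [X FX <-] [Y FY <-].
  by case: (Ftot _ _ FX FY) => XY; [left|right]; apply: setUS.
exists (A `|` X); split=> [|x Ax|C PC AXC]; [exact: PX|by left|].
apply: contrapT => nCAX; apply: (Xmax C); last first.
  by rewrite setUidr // => x Ax; apply: AXC; left.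
split=> [x Xx|CX]; first by apply: AXC; right.
by apply: nCAX => x /CX; right.
Qed.

Section ClosedSets.
Variable R : comNzRingType.

(** Closure is phrased for sets because Zorn's lemma produces a union of sets; [is_subringE] turns
    the result back into a [subringClosed]. *)
Definition is_subring (A : set R) : Prop :=
  [/\ A 1, forall x y, A x -> A y -> A (x - y)
         & forall x y, A x -> A y -> A (x * y)].

Lemma is_subring_pred (S : subringClosed R) : is_subring [set x | x \in S].
Proof.
by split=> [|x y|x y] /=; [exact: rpred1|exact: rpredB|exact: rpredM].
Qed.

Lemma is_subringE (A : set R) : is_subring A ->
  exists S : subringClosed R, A = [set x | x \in S].
Proof.
move=> [A1 AB AM]; pose P : R -> bool := fun x => `[< A x >].
have Pcl : subring_closed P.
  split; rewrite ?unfold_in; first exact/asboolP.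
    by move=> x y /asboolP Ax /asboolP Ay; apply/asboolP/AB.
  by move=> x y /asboolP Ax /asboolP Ay; apply/asboolP/AM.
pose S : subringClosed R := HB.pack P (GRing.isSubringClosed.Build R P Pcl).
by exists S; apply/seteqP; split=> x; [move=> Ax; apply/asboolP|move/asboolP].
Qed.

Lemma is_subring_bigcup (F : set (set R)) :
    F !=set0 -> F `<=` is_subring -> total_on F subset ->
  is_subring (\bigcup_(X in F) X).
Proof.
move=> [X0 FX0] Fsub Ftot.
have Fdir x y : (\bigcup_(X in F) X) x -> (\bigcup_(X in F) X) y ->
    exists X, [/\ F X, X x & X y].
  move=> [X FX Xx] [Y FY Yy].
  by case: (Ftot _ _ FX FY) => XY; [exists Y|exists X]; split=> //; apply: XY.
split=> [|x y Fx Fy|x y Fx Fy]; first by exists X0 => //; case: (Fsub _ FX0).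
- have [X [FX Xx Xy]] := Fdir _ _ Fx Fy; exists X => //.
  by case: (Fsub _ FX) => _ + _; apply.
- have [X [FX Xx Xy]] := Fdir _ _ Fx Fy; exists X => //.
  by case: (Fsub _ FX) => _ _; apply.
Qed.

Definition is_proper_ideal (I : set R) : Prop :=
  [/\ I 0, ~ I 1 & forall a x y, I x -> I y -> I (a * x + y)].

Lemma is_proper_idealE (I : set R) : is_proper_ideal I ->
  exists J : idealr R, I = [set x | x \in J].
Proof.
move=> [I0 I1 IZ]; pose P : R -> bool := fun x => `[< I x >].
have Pcl : idealr_closed P.
  split; rewrite ?unfold_in; [exact/asboolP|exact/asboolP|].
  by move=> a x y /asboolP Ix /asboolP Iy; apply/asboolP/IZ.
pose J : idealr R := HB.pack P (isIdealr.Build R P Pcl).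
by exists J; apply/seteqP; split=> x; [move=> Ax; apply/asboolP|move/asboolP].
Qed.

Lemma exists_maximal_ideal : exists I : set R, is_proper_ideal I /\
  forall J, is_proper_ideal J -> I `<=` J -> J `<=` I.
Proof.
have P0 : is_proper_ideal [set 0].
  split=> //= [/eqP|a x y -> ->]; first by rewrite oner_eq0.
  by rewrite mulr0 addr0.
have [F F0 Fid Ftot|I [PI _ Imax]] := Zorn_above P0; last by exists I.
case: F0 => X0 FX0; split.
- by exists X0 => //; case: (Fid _ FX0).
- by move=> [X FX X1]; case: (Fid _ FX) => _ /(_ X1).
- move=> a x y [X FX Xx] [Y FY Yy].
  case: (Ftot _ _ FX FY) => XY.
    by exists Y => //; case: (Fid _ FY) => _ _; apply => //; apply: XY.
  by exists X => //; case: (Fid _ FX) => _ _; apply => //; apply: XY.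
Qed.

End ClosedSets.

(** * Residue fields *)

(** The field is [A] itself, with inverses picked by choice and 0 sent to 0. *)
Lemma comring_to_field (A : comNzRingType) :
    (forall x : A, x != 0 -> exists y, y * x = 1) ->
  exists (K : fieldType), inhabited {rmorphism A -> K}.
Proof.
move=> Ainv.
have [inv invP] : {inv : A -> A &
    forall x, (x != 0 -> inv x * x = 1) /\ (x = 0 -> inv x = 0)}.
  apply: (@choice _ _ (fun x z => (x != 0 -> z * x = 1) /\ (x = 0 -> z = 0))).
  move=> x; have [->|/[dup] xN0 /Ainv[y yx]] := eqVneq x 0.
    by exists 0; split=> //; rewrite eqxx.
  by exists y; split=> // x0; rewrite x0 eqxx in xN0.
have mulVf x : x != 0 -> inv x * x = 1 by case: (invP x).
have inv0 : inv 0 = 0 by case: (invP 0) => _; apply.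
pose K : fieldType := HB.pack A (GRing.ComNzRing_isField.Build A mulVf inv0).
by exists K; split; exact: (idfun : {rmorphism A -> A}).
Qed.

Lemma exists_residue_field (R : comNzRingType) :
  exists K : fieldType, inhabited {rmorphism R -> K}.
Proof.
have [I [+ Imax]] := exists_maximal_ideal R.
move=> /[dup] PI /is_proper_idealE [J defI].
have [|K [f]] := @comring_to_field {ideal_quot J}; last first.
  by exists K; split; exact: (f \o \pi_({ideal_quot J})).
elim/quotW => x xN0.
have piE u v : u - v \in J -> \pi_({ideal_quot J}) u = \pi_({ideal_quot J}) v.
  by move=> uvJ; apply/eqP; rewrite -Quotient.idealrBE.
have JxN : x \notin J.
  apply: contra xN0 => xJ; apply/eqP.
  by rewrite -(rmorph0 (\pi_({ideal_quot J}))); apply: piE; rewrite subr0.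
apply: contrapT => nex.
case: PI => I0 I1 IZ.
(* [H] is the ideal generated by [I] and [x]. It is proper, since 1 in [H] would invert [x] modulo
   [I]; maximality then puts [x] in [I]. *)
pose H := [set z | exists a i, I i /\ z = a * x + i].
have HI : H `<=` I.
  apply: Imax; last by move=> i Ii; exists 0, i; rewrite mul0r add0r.
  split.
  - by exists 0, 0; rewrite mul0r addr0.
  - move=> [a [i [Ii e]]]; apply: nex; exists (\pi a).
    have -> : 1 = \pi_({ideal_quot J}) 1 by rewrite rmorph1.
    rewrite -rmorphM; apply: piE; rewrite e opprD addrA subrr sub0r rpredN.
    by rewrite defI in Ii.
  - move=> a _ _ [b [i [Ii ->]]] [c [j [Ij ->]]].
    exists (a * b + c), (a * i + j); split; first exact: IZ.
    by rewrite mulrDr mulrDl !mulrA addrACA.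
have : I x by apply: HI; exists 1, 0; rewrite mul1r addr0.
by rewrite defI /=; apply/negP.
Qed.

(** * Discrete valuation rings and the Gauss extension *)

Section DiscreteValuationRings.
Variables (K : fieldType) (t : K).
Hypothesis t0 : t != 0.

(* [A] is a discrete valuation ring with uniformizer [t]; its fraction field
   [A[1/t]] may be smaller than [K]. *)
Definition is_dvr (A : set K) : Prop :=
  [/\ is_subring A, A t, ~ A t^-1 &
      forall x, A x -> x != 0 -> exists k u, [/\ A u, A u^-1 & x = t ^+ k * u]].

Lemma is_dvr_bigcup (F : set (set K)) :
    F !=set0 -> F `<=` is_dvr -> total_on F subset ->
  is_dvr (\bigcup_(X in F) X).
Proof.
move=> F0 Fdvr Ftot; have [X0 FX0] := F0; split.
- by apply: is_subring_bigcup => // X /Fdvr [].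
- by exists X0 => //; case: (Fdvr _ FX0).
- by move=> [X /Fdvr [_ _ ntV _] Xt].
- move=> x [X FX Xx] x0; have [_ _ _ Xfac] := Fdvr _ FX.
  by have [k [u [Xu XVu ->]]] := Xfac _ Xx x0; exists k, u; split=> //;
    exists X.
Qed.

Section Gauss.
Variable S : subringClosed K.
Hypothesis S_dvr : is_dvr [set x | x \in S].

Let St : t \in S. Proof. by case: S_dvr. Qed.
Let StV : t^-1 \notin S. Proof. by apply/negP; case: S_dvr. Qed.

(** In [x = t ^+ k * u] a positive [k] would put [x / t] in [S], so [x] is the unit [u]. *)
Lemma dvr_unit (x : K) : x \in S -> x / t \notin S -> x^-1 \in S.
Proof.
move=> Sx; have [->|x0] := eqVneq x 0; first by rewrite mul0r rpred0.
have [_ _ _ /(_ x Sx x0)[[|k] [u [/= Su SuV ->]]]] := S_dvr.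
  by rewrite mul1r.
by rewrite exprSr mulrAC mulfK // rpredM ?rpredX.
Qed.

(** Over [S] contents are powers of [t] up to units, so Gauss's primitivity means that [t] does not
    divide all coefficients. *)
Definition primitive (f : {poly K}) : Prop :=
  f \is a polyOver S /\ t^-1 *: f \isn't a polyOver S.

Lemma primitive_coef (f : {poly K}) : primitive f ->
  exists i, f`_i / t \notin S /\ forall j, (j < i)%N -> f`_j / t \in S.
Proof.
move=> [_ tf]; have exi : exists i, f`_i / t \notin S.
  apply: contrapT => nex; move/negP: tf; apply; apply/polyOverP => i.
  by rewrite coefZ mulrC; apply: contrapT => /negP ?; apply: nex; exists i.
case: (ex_minnP exi) => i fi imin; exists i; split=> // j ltji.
by apply: contraLR ltji => /imin; rewrite -leqNgt.
Qed.

Lemma primitive1 : primitive 1.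
Proof.
split; first exact: rpred1.
by rewrite alg_polyC polyOverC.
Qed.

(* The minimal indices of unit coefficients add up, as in Gauss's lemma. *)
Lemma primitiveM (f g : {poly K}) : primitive f -> primitive g ->
  primitive (f * g).
Proof.
move=> Pf Pg; have [[Sf _] [Sg _]] := (Pf, Pg).
split; first exact: rpredM.
have [i [fi fmin]] := primitive_coef Pf.
have [j [gj gmin]] := primitive_coef Pg.
have {}Sf k : f`_k \in S by apply/polyOverP.
have {}Sg k : g`_k \in S by apply/polyOverP.
apply/negP => /polyOverP/(_ (i + j)%N).
have lti : (i < (i + j).+1)%N by rewrite ltnS leq_addr.
rewrite coefZ coefM (bigD1 (Ordinal lti)) //= addKn mulrDr mulr_sumr rpredDr.
  rewrite mulrC => fgS; move/negP: StV; apply.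
  have -> : t^-1 = (f`_i)^-1 * ((f`_i * g`_j / t) * (g`_j)^-1).
    have fi0 : f`_i != 0 by apply: contraNneq fi => ->; rewrite mul0r rpred0.
    have gj0 : g`_j != 0 by apply: contraNneq gj => ->; rewrite mul0r rpred0.
    by rewrite [_ * g`_j / t]mulrAC mulfK // mulKf.
  by rewrite rpredM ?dvr_unit // rpredM ?dvr_unit.
apply: rpred_sum => -[k ltk] /= /eqP neki.
have [ltki|leik] := ltnP k i; first by rewrite mulrA rpredM // mulrC fmin.
rewrite mulrCA rpredM // mulrC gmin // ltn_subLR // ltn_add2r.
by rewrite ltn_neqAle leik andbT; apply/eqP => eik; apply: neki; apply: val_inj.
Qed.

(** Take the largest [k] such that [t ^- k *: f] is still over [S]. The exponent [m] of [t] in the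
    leading coefficient bounds it: a larger one would put [t^-1] in [S]. *)
Lemma primitive_part (f : {poly K}) : f \is a polyOver S -> f != 0 ->
  exists k g, primitive g /\ f = t ^+ k *: g.
Proof.
move=> Sf f0.
pose P n := t ^- n *: f \is a polyOver S.
have P0 : exists n, P n by exists 0; rewrite /P expr0 invr1 scale1r.
have [_ _ _ /(_ (lead_coef f))[]] := S_dvr.
- by apply/(polyOverP Sf).
- by rewrite lead_coef_eq0.
move=> m [u [/= Su SuV fE]].
have Pub n : P n -> (n <= m)%N.
  move=> /polyOverP/(_ (size f).-1); rewrite coefZ -lead_coefE fE mulrA.
  move=> Sn; rewrite leqNgt; apply/negP => ltmn; move/negP: StV; apply.
  have u0 : u != 0.
    by move: f0; rewrite -lead_coef_eq0 fE mulf_eq0 negb_or => /andP[].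
  have [e nE] : exists e, n = (e + m.+1)%N.
    by exists (n - m.+1)%N; rewrite subnK.
  suff -> : t^-1 = t ^+ e * (t ^- n * t ^+ m * u * u^-1).
    by apply: rpredM; [exact: rpredX|exact: rpredM].
  rewrite mulfK // nE exprD exprS !invfM -!mulrA mulVf ?expf_neq0 // mulr1.
  by rewrite mulVKf // expf_neq0.
case: (ex_maxnP P0 Pub) => k Pk kmax.
exists k, (t ^- k *: f); split; last first.
  by rewrite scalerA mulfV ?expf_neq0 ?scale1r.
split=> //; apply/negP; rewrite scalerA -invfM -exprS.
by move/kmax; rewrite ltnn.
Qed.

(** In the Gauss extension, [primitiveM] supplies common denominators for differences and products,
    and the primitive part of a numerator gives the factorization into a power of [t] and a unit. *)
Lemma dvr_transcendental (y : K) :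
    (forall f, f \is a polyOver S -> f.[y] = 0 -> f = 0) ->
  exists A, [/\ is_dvr A, [set x | x \in S] `<=` A & A y].
Proof.
move=> y_tr.
have prim0 g : primitive g -> g.[y] != 0.
  move=> [Sg tg]; apply: contraNneq tg => /(y_tr g Sg) ->.
  by rewrite scaler0 rpred0.
pose A := [set x | exists f g, [/\ f \is a polyOver S, primitive g
                                 & x = f.[y] / g.[y]]].
have SA x : x \in S -> A x.
  move=> Sx; exists x%:P, 1; split; first by rewrite polyOverC.
    exact: primitive1.
  by rewrite !hornerE divr1.
exists A; split=> //; last first.
  exists 'X, 1; split; [exact: polyOverX|exact: primitive1|].
  by rewrite !hornerE divr1.
split; last first.
- move=> x [f [g [Sf Pg ->]]] x0.
  have f0 : f != 0 by apply: contraNneq x0 => ->; rewrite horner0 mul0r.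
  have [k [h [Ph ->]]] := primitive_part Sf f0.
  exists k, (h.[y] / g.[y]); split; last by rewrite hornerZ mulrA.
    by exists h, g; split=> //; case: Ph.
  by exists g, h; split=> //; [case: Pg|rewrite invf_div].
(* If [t^-1] were [f.[y] / g.[y]], transcendence of [y] would give [g = t *: f], against primitivity
   of [g]. *)
- move=> [f [g [Sf Pg e]]]; have g0 := prim0 _ Pg; case: Pg => Sg /negP; apply.
  suff -> : g = t *: f by rewrite scalerA mulVf // scale1r.
  apply/eqP; rewrite -subr_eq0; apply/eqP/y_tr.
    by rewrite rpredB // polyOverZ.
  by rewrite !hornerE -[f.[y]](divfK g0) -e mulrA mulfV // mul1r subrr.
- exact: SA.
split; first exact/SA/rpred1.
- move=> _ _ [f [g [Sf Pg ->]]] [f' [g' [Sf' Pg' ->]]].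
  have [[Sg _] [Sg' _]] := (Pg, Pg').
  exists (f * g' - f' * g), (g * g'); split; [|exact: primitiveM|].
    by rewrite rpredB ?rpredM.
  by rewrite !hornerE -mulNr addf_div ?prim0 // mulNr.
- move=> _ _ [f [g [Sf Pg ->]]] [f' [g' [Sf' Pg' ->]]].
  exists (f * f'), (g * g'); split; [by rewrite rpredM|exact: primitiveM|].
  by rewrite !hornerM mulf_div.
Qed.

Let RtoK : {rmorphism subring_sort S -> K} := (val : subring_sort S -> K).

(** The exponent [k] is that of [t] in the leading coefficient of [f]; rescaling the variable by
    [t ^+ k] absorbs this coefficient up to a unit. *)
Lemma dvr_integral_multiple (f : {poly K}) (y : K) :
    f \is a polyOver S -> f != 0 -> root f y ->
  exists k, integralOver (val : subring_sort S -> K) (t ^+ k * y).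
Proof.
move=> Sf f0 fy; have S_coef i : f`_i \in S by apply/polyOverP.
have [_ _ _ /(_ (lead_coef f))[]] := S_dvr; first exact: S_coef.
  by rewrite lead_coef_eq0.
move=> k [u [/= Su SuV fE]]; exists k; set c := t ^+ k in fE *.
have Sc : c \in S by rewrite rpredX.
have c0 : c != 0 by rewrite expf_neq0.
have u0 : u != 0.
  by move: f0; rewrite -lead_coef_eq0 fE mulf_eq0 negb_or => /andP[].
have sf : (1 < size f)%N.
  rewrite ltnNge; apply/negP => /size1_polyC fC.
  by move: fy f0; rewrite fC rootC polyC_eq0 => ->.
have [d sfE] : exists d, size f = d.+2.
  by case: (size f) sf => [|[|d]] //; exists d.
have fd : f`_d.+1 = c * u by rewrite -fE lead_coefE sfE.
(* Up to a unit, [g] is [c ^ d * f(X / c)], made monic since [f] has leading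
   coefficient [c * u]. *)
pose g := \poly_(i < d.+2) (f`_i / u * c ^+ d / c ^+ i).
have Ed : f`_d.+1 / u * c ^+ d / c ^+ d.+1 = 1.
  by rewrite fd mulfK // -exprS mulfV // expf_neq0.
have gd : g`_d.+1 = 1 by rewrite coef_poly ltnSn.
have g_mon : g \is monic by rewrite monicE lead_coef_poly //= Ed // oner_neq0.
have Sg i : g`_i \in S.
  have [->|neid] := eqVneq i d.+1; first by rewrite gd rpred1.
  rewrite coef_poly; case: ifP => [ltid|_]; last exact: rpred0.
  (* Below the top index, [c ^+ d / c ^+ i] is a genuine power of [c]. Only at [i = d.+1] is there a
     division by [c], which cancels against the leading coefficient. *)
  have leid : (i <= d)%N by rewrite -ltnS ltn_neqAle neid -ltnS.
  rewrite -(subnK leid) exprD -mulrA mulfK ?expf_neq0 //.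
  by rewrite !rpredM ?rpredX.
apply: (@integral_root_monic _ _ RtoK _ g) => //.
  rewrite rootE horner_poly.
  have -> : \sum_(i < d.+2) (f`_i / u * c ^+ d / c ^+ i) * (c * y) ^+ i =
            c ^+ d / u * f.[y].
    rewrite horner_coef sfE mulr_sumr; apply: eq_bigr => i _.
    rewrite exprMn mulrA divfK ?expf_neq0 // mulrA; congr (_ * _).
    by rewrite mulrC mulrCA mulrC.
  by rewrite (rootP fy) mulr0.
move=> z /(nthP 0)[i _ <-].
rewrite -[g`_i](SubK (subring_sort S) (Sg i)); exact: (integral_id RtoK).
Qed.

(** Multiply a monic equation of degree [d.+1] for [x^-1] by [x ^+ d] and solve for [x^-1]. *)
Lemma integral_inv_mem (x : K) : x \in S -> x != 0 ->
  integralOver (val : subring_sort S -> K) x^-1 -> x^-1 \in S.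
Proof.
move=> Sx x0 [q q_mon qx]; have {qx} : root (map_poly RtoK q) x^-1 by [].
have := monic_map RtoK q_mon; set r := map_poly _ q => r_mon.
have Sr i : r`_i \in S by rewrite coef_map; exact: valP.
rewrite rootE horner_coef; case sr: (size r) => [|[|d]].
- by move: (monic_neq0 r_mon); rewrite -size_poly_eq0 sr.
- move: (r_mon); rewrite big_ord1 mulr1 monicE lead_coefE sr /= => /eqP ->.
  by rewrite oner_eq0.
rewrite big_ord_recr /=; have -> : r`_d.+1 = 1.
  by move/monicP: r_mon; rewrite lead_coefE sr.
rewrite mul1r => /eqP rx.
have -> : x^-1 = - \sum_(i < d.+1) r`_i * x ^+ (d - i).
  have := congr1 ( *%R (x ^+ d)) rx.
  rewrite mulr0 mulrDr mulr_sumr [x^-1 ^+ _]exprSr exprVn mulVKf ?expf_neq0 //.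
  move/eqP; rewrite addrC addr_eq0 => /eqP ->; congr (- _).
  apply: eq_bigr => -[i /=]; rewrite ltnS => leid _.
  by rewrite -[in x ^+ d](subnK leid) exprD mulrCA exprVn mulfK ?expf_neq0.
by rewrite rpredN rpred_sum // => i _; rewrite rpredM ?rpredX.
Qed.
End Gauss.
End DiscreteValuationRings.

(** * The localization of the integers at a prime *)

Definition localization_at (K : fieldType) (p : nat) : set K :=
  [set x | exists a b : int, ~~ (p %| b)%Z /\ x = a%:~R / b%:~R].
Arguments localization_at K p : clear implicits.

Lemma localization_at_inv (K : fieldType) (p q : nat) :
  prime p -> prime q -> q != p -> localization_at K p q%:R^-1.
Proof.
move=> p_pr q_pr neqp; exists 1, (Posz q); split; last by rewrite mul1r.
by rewrite dvdzE /= dvdn_prime2 // eq_sym.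
Qed.

(** The morphism [g] gives [K] characteristic 0, so denominators prime to [p] do not vanish in
    [K]. *)
Lemma localization_at_dvr (K : fieldType) (g : {rmorphism rat -> K}) (p : nat) :
  prime p -> is_dvr p%:R (localization_at K p).
Proof.
move=> p_pr.
have int0 (b : int) : (b%:~R == 0 :> K) = (b == 0).
  by rewrite -(rmorph_int g) fmorph_eq0 intr_eq0.
have unit0 (b : int) : ~~ (p %| b)%Z -> b%:~R != 0 :> K.
  by rewrite int0; apply: contraNneq => ->; rewrite dvdz0.
have unitM (b d : int) : ~~ (p %| b)%Z -> ~~ (p %| d)%Z -> ~~ (p %| b * d)%Z.
  by rewrite !dvdzE abszM Euclid_dvdM // negb_or => -> ->.
have unit1 : ~~ (p %| 1)%Z by rewrite dvdzE dvdn1 neq_ltn prime_gt1 ?orbT.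
split; first split.
- by exists 1, 1; rewrite divr1.
- move=> _ _ [a [b [pb ->]]] [c [d [pd ->]]].
  exists (a * d - c * b), (b * d); split; first exact: unitM.
  by rewrite -mulNr addf_div ?unit0 // mulNr !(rmorphM, rmorphB).
- move=> _ _ [a [b [pb ->]]] [c [d [pd ->]]].
  exists (a * c), (b * d); split; first exact: unitM.
  by rewrite mulf_div !rmorphM.
- by exists (Posz p), 1; rewrite divr1.
- move=> [a [b [pb e]]]; move/negP: (pb); apply; apply/dvdzP; exists a.
  apply/eqP; rewrite -subr_eq0 -int0 rmorphB rmorphM subr_eq0 /=.
  have p0 : p%:R != 0 :> K by rewrite (int0 (Posz p)) eqz_nat -lt0n prime_gt0.
  by rewrite -[a%:~R](divfK (unit0 _ pb)) -e mulrAC mulVf // mul1r.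
- move=> _ [a [b [pb ->]]] x0.
  have a0 : a != 0 by apply: contraNneq x0 => ->; rewrite mul0r.
  have : (0 < `|a|)%N by rewrite absz_gt0.
  move/(pfactor_coprime p_pr) => [m pm aE]; set k := logn p `|a| in aE.
  (* [a'] is the part of [a] prime to [p], with its sign, so [a' / b] is a unit of the
     localization. *)
  pose a' : int := Num.sg a * m.
  have pa' : ~~ (p %| a')%Z.
    by rewrite dvdzE abszM absz_sg a0 mul1n /= -prime_coprime.
  exists k, (a'%:~R / b%:~R); split.
  + by exists a', b.
  + by exists b, a'; rewrite invf_div.
  + rewrite mulrA; congr (_ / _).
    rewrite [in LHS](intEsg a) aE PoszM mulrA !rmorphM mulrC; congr (_ * _).
    by rewrite -natrX.
Qed.

(** * Construction of the maximal subrings *)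

Lemma exists_algebraic_dvr (K : fieldType) (t : K) (A : set K) :
    t != 0 -> is_dvr t A ->
  exists S : subringClosed K, [/\ is_dvr t [set x | x \in S],
    A `<=` [set x | x \in S] &
    forall y, exists f, [/\ f \is a polyOver S, f != 0 & root f y]].
Proof.
move=> t0 /(Zorn_above) [|B [Bdvr AB Bmax]]; first exact: is_dvr_bigcup.
have [S defB] : exists S : subringClosed K, B = [set x | x \in S].
  by apply: is_subringE; case: Bdvr.
rewrite {}defB in Bdvr AB Bmax; exists S; split=> // y.
apply: contrapT => nex.
have [|C [Cdvr SC Cy]] := @dvr_transcendental K t t0 S Bdvr y.
  move=> f Sf fy; apply/eqP; apply: contrapT => /negP f0; apply: nex.
  by exists f; split=> //; apply/rootP.
(* Maximality forces [y] itself into [S], so ['X - y%:P] has coefficients in [S] and shows that [y]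
   is algebraic after all. *)
apply: nex; exists ('X - y%:P); split; last by rewrite root_XsubC.
  by rewrite polyOverXsubC; apply: (Bmax C).
by rewrite polyXsubC_eq0.
Qed.

(** A subring containing [B] and [w] contains every [x = w ^+ k * (t ^+ k * x)], hence is all of
    [R]. So proper subrings above [B] omit [w], and maximality among those omitting [w] is
    maximality among all proper ones. *)
Lemma exists_maximal_subring (R : comNzRingType) (B : set R) (t w : R) :
    t * w = 1 -> is_subring B -> ~ B w ->
    (forall x, exists k, B (t ^+ k * x)) ->
  exists S : subringClosed R, [/\ maximal_subring S, B `<=` [set x | x \in S]
                                & w \notin S].
Proof.
move=> tw Bsub nBw Blocal.
have [F F0 FP Ftot|C [[Csub nCw] BC Cmax]] :=
  @Zorn_above R (fun X => is_subring X /\ ~ X w) B (conj Bsub nBw).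
  split; last by move=> [X FX Xw]; case: (FP _ FX).
  by apply: is_subring_bigcup => // X /FP [].
have [S defC] := is_subringE Csub; rewrite {}defC in nCw BC Cmax {Csub}.
have nSw : w \notin S by apply/negP.
exists S; split=> //; split; first by exists w.
move=> T [x nTx] ST y; apply/idP/idP => [|Ty]; first exact: ST.
apply: (Cmax [set z | z \in T]) => //; split; first exact: is_subring_pred.
move=> Tw; move/negP: nTx; apply.
have [k Bx] := Blocal x.
have -> : x = w ^+ k * (t ^+ k * x).
  by rewrite mulrA -exprMn [w * t]mulrC tw expr1n mul1r.
by rewrite rpredM ?rpredX //; apply/ST/BC.
Qed.

Lemma exists_maximal_subring_at (R : comNzRingType)
    (iota : {rmorphism rat -> R}) (p : nat) : prime p ->
  exists S : subringClosed R, maximal_subring S /\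
    forall q, prime q -> (iota q%:R^-1 \in S) = (q != p).
Proof.
move=> p_pr; have [K [f]] := exists_residue_field R.
have iotaV q : prime q -> q%:R * iota q%:R^-1 = 1.
  move=> q_pr; rewrite -(rmorph_nat iota) -rmorphM mulfV ?rmorph1 //.
  by rewrite Num.Theory.pnatr_eq0; case: q q_pr.
have fV q : prime q -> f (iota q%:R^-1) = q%:R^-1.
  move=> q_pr; rewrite -[RHS]mulr1; apply: (canRL (mulKf _)).
    have := iotaV q q_pr; move/(congr1 f).
    rewrite rmorphM rmorph_nat rmorph1 => /eqP e.
    by apply: contraL e => /eqP ->; rewrite mul0r eq_sym oner_eq0.
  by rewrite -(rmorph_nat f) -rmorphM iotaV // rmorph1.
have p0 : p%:R != 0 :> K.
  have := congr1 f (iotaV p p_pr); rewrite rmorphM rmorph_nat rmorph1 => e.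
  by apply: contra_eq_neq e => ->; rewrite mul0r eq_sym oner_eq0.
have := @localization_at_dvr K (f \o iota) p p_pr.
move=> /(exists_algebraic_dvr p0) [D [Ddvr locD Dalg]].
pose RtoK : {rmorphism subring_sort D -> K} := (val : subring_sort D -> K).
pose B := [set x | integralOver RtoK (f x)].
have [||k|S [Smax BS Sw]] := @exists_maximal_subring R B _ _ (iotaV p p_pr).
- split=> [|x y|x y]; rewrite /B /=.
  + by rewrite rmorph1; exact: (integral1 RtoK).
  + by rewrite rmorphB; exact: (@integral_sub _ _ RtoK).
  + by rewrite rmorphM; exact: (@integral_mul _ _ RtoK).
(* If the inverse of [p] were integral over [D], it would lie in [D] by [integral_inv_mem], as [p]
   does. *)
- rewrite /B /= fV //; case: Ddvr => _ Dp nDp _ pV_int.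
  exact/nDp/integral_inv_mem.
- have [h [Dh h0 hx]] := Dalg (f k).
  have [m hm] := dvr_integral_multiple p0 Ddvr Dh h0 hx.
  by exists m; rewrite /B /= rmorphM rmorphXn rmorph_nat.
exists S; split=> // q q_pr; have [->|neqp] := eqVneq q p; first exact/negbTE.
apply: BS; rewrite /B /= fV //.
have Dq : q%:R^-1 \in D by apply/locD/localization_at_inv.
by rewrite -[q%:R^-1](SubK (subring_sort D) Dq); apply: (integral_id RtoK).
Qed.

(** * Separating the isomorphism classes *)

Lemma infinite_primes : infinite_set [set p | prime p].
Proof.
move=> /finite_seqP [s sE]; have [p ltp p_pr] := prime_above (\max_(i <- s) i).
have : p \in s by have : [set p | prime p] p by []; rewrite sE.
by move/(@leq_bigmax_seq nat s xpredT (fun i => i))/(_ isT); rewrite leqNgt ltp.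
Qed.

(** An isomorphism fixes [n], and inverses are unique in [R], so it sends [w] to [w]. *)
Lemma ring_isomorphic_inv_mem (R : comNzRingType) (S T : subringClosed R)
    (n : nat) (w : R) : n%:R * w = 1 ->
  ring_isomorphic (subring_sort S) (subring_sort T) -> w \in S -> w \in T.
Proof.
move=> nw [f _] Sw; pose z : subring_sort S := Sub w Sw.
have nz : n%:R * z = 1 by apply: val_inj; rewrite rmorphM rmorph_nat rmorph1.
have := congr1 (fun u : subring_sort S => val (f u)) nz.
rewrite !rmorphM !rmorph_nat !rmorph1 => nfz.
suff -> : w = val (f z) by exact: valP.
by rewrite -[LHS]mulr1 -nfz mulrCA mulrA nw mul1r.
Qed.

Theorem corollary3p12 (R : comNzRingType) (iota : {rmorphism rat -> R})
    (iota_inj : injective iota) :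
  infinite_set (maximal_subring_classes R).
Proof.
have [S SP] : {S : nat -> subringClosed R & forall p, prime p ->
    maximal_subring (S p) /\
    forall q, prime q -> (iota q%:R^-1 \in S p) = (q != p)}.
  apply: (@choice _ _ (fun p (S : subringClosed R) => prime p ->
    maximal_subring S /\
    forall q, prime q -> (iota q%:R^-1 \in S) = (q != p))) => p.
  have [/(exists_maximal_subring_at iota) [S SP]|npr] := boolP (prime p).
    by exists S.
  (* Choice needs a value at every index; at a non-prime one any subring will do. *)
  by have [S _] := exists_maximal_subring_at iota (isT : prime 2); exists S.
pose F p := maximal_subring_class (S p).
have F_inj p q : prime p -> prime q -> F p = F q -> p = q.
  move=> p_pr q_pr Fpq; have [[_ Sp] [Sq_max Sq]] := (SP p p_pr, SP q q_pr).
  (* [S q] belongs to its own class, so equal classes make [S p] and [S q] isomorphic. If [p] and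
     [q] differed, the inverse of [q] would pass from [S p] to [S q]. *)
  have [_ isopq] : F p (S q).
    by rewrite Fpq; split=> //; exists idfun; exists id.
  have qV : q%:R * iota q%:R^-1 = 1.
    rewrite -(rmorph_nat iota) -rmorphM mulfV ?rmorph1 //.
    by rewrite Num.Theory.pnatr_eq0 -lt0n prime_gt0.
  have := ring_isomorphic_inv_mem qV isopq; rewrite Sp // Sq // eqxx.
  by case: eqP => [->|_ /(_ isT)].
move=> fin; apply: infinite_primes.
have FI : {in [set p | prime p] &, injective F}.
  by move=> p q; rewrite !inE; exact: F_inj.
rewrite -(eq_finite_set (inj_card_eq FI)); apply: sub_finite_set fin.
by move=> _ [p p_pr <-]; exists (S p) => //; case: (SP p p_pr).
Qed.
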